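(* Let $k\geq 2$ be an integer, let $\mu^{(k)}$ be the indicator function of the $k$-free positive integers, and let $\gamma_n^{M,k}$ ($n\ge 0$) be the coefficients of the regular part of the Laurent expansion about $s=1$ $$\frac{\zeta(s)}{\zeta(ks)}=\frac{1}{\zeta(k)(s-1)}+\sum_{n=0}^{\infty}\gamma_n^{M,k}\,\frac{(s-1)^n}{n!}.$$ Then for every integer $n\geq 0$, $$\gamma^{M,k}_n=\lim_{x\to\infty}(-1)^n\left\{\sum_{1\le j\le x}\frac{\mu^{(k)}(j)\log^n(j)}{j}-\frac{\log^{n+1}(x)}{\zeta(k)(n+1)}\right\}.$$
   Context: $\zeta$ is the Riemann zeta function (meromorphically continued to $\mathbb{C}$). A positive integer $n$ is $k$-free if it is not divisible by $d^k$ for any integer $d>1$. The function $\mu^{(k)}(n)$ equals $1$ if $n$ is $k$-free and $0$ otherwise; equivalently $\mu^{(k)}(n)=\sum_{d^k\mid n}\mu(d)$ with $\mu$ the Möbius function. For $\Re(s)>1$ one has $\zeta(s)/\zeta(ks)=\sum_{n\ge1}\mu^{(k)}(n)n^{-s}$. The function $\zeta(s)/\zeta(ks)$ has a simple pole at $s=1$ with residue $1/\zeta(k)$, and the Laurent expansion is taken in a punctured neighbourhood of $s=1$. $\log^n(j)$ means $(\log j)^n$, with the convention $0^0=1$ (so $\log^0(1)=1$). *)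

(* Defs.v *)
(* Rocq Stdlib reals, with Coquelicot for complex numbers, limits and series. *)
From Stdlib Require Import Reals Factorial ClassicalEpsilon.
From Coquelicot Require Import Coquelicot.
Open Scope R_scope.

Definition kfree (k n : nat) : Prop :=
  (0 < n)%nat /\ forall d : nat, (1 < d)%nat -> ~ Nat.divide (d ^ k) n.

Definition mu_kfree (k n : nat) : R :=
  if excluded_middle_informative (kfree k n) then 1 else 0.

Definition Cexp (z : C) : C :=
  (exp (Re z) * cos (Im z), exp (Re z) * sin (Im z)).

(* [nat_Cpow n s] is n^s for n >= 1; at n = 0 it has no meaning. *)
Definition nat_Cpow (n : nat) (s : C) : C := Cexp (s * RtoC (ln (INR n)))%C.

(* [z] is the meromorphic continuation of sum_{n >= 1} n^{-s}.  By the identity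
   theorem these two conditions determine [z] on C \ {1}; the junk value [z 1]
   at the pole is left unconstrained. *)
Definition is_riemann_zeta (z : C -> C) : Prop :=
  (forall s : C, 1 < Re s ->
     is_series (V := C_NormedModule)
       (fun m : nat => nat_Cpow (S m) (- s)%C) (z s)) /\
  (forall s : C, s <> RtoC 1 ->
     ex_derive (K := C_AbsRing) (V := C_NormedModule) z s).

(* In a punctured neighbourhood of [a],
     F s = res / (s - a) + sum_{n >= 0} c n * (s - a)^n / n!. *)
Definition is_laurent_simple_pole (F : C -> C) (a res : C) (c : nat -> C) :
  Prop :=
  exists r : R, 0 < r /\
    forall s : C, 0 < Cmod (s - a)%C < r ->
      is_series (V := C_NormedModule)
        (fun n : nat => c n * ((s - a) ^ n / RtoC (INR (fact n))))%C
        (F s - res / (s - a))%C.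

(* The sum over the integers 1 <= j <= x, for x >= 0. *)
Definition sum_upto (f : nat -> R) (x : R) : R :=
  sum_n_m f 1 (Z.to_nat (Int_part x)).

(* Main.v *)
(* Everything happens on the real half-line s = 1 + d, d > 0. Write a for the indicator of the
   k-free numbers, c = 1 / zeta(k) and A(N) = sum_(j <= N) a(j). Every positive integer is uniquely
   m d^k with m k-free; this gives both zeta(s) = zeta(ks) sum_m a(m) m^(-s) and the power-saving
   count A(N) = c N + O(N^(15/16)). By summation by parts the regularized sum
   Lambda(phi) = lim_N (sum_(j <= N) a(j) phi(j) - c int_1^N phi) exists and is bounded by a constant
   times M whenever phi and phi' are bounded by M times suitable powers of x. With
   L_m = Lambda(log^m x / x), applying Lambda to
     x^(-1-d) = sum_(m <= n) (-d)^m / m! log^m x / x + (Taylor remainder)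
   yields F(1 + d) - c / d = sum_(m <= n) (-1)^m L_m d^m / m! + O(d^(n+1)), where
   F(s) = zeta(s) / zeta(ks), and comparison with the Laurent expansion gives
   gamma_m = (-1)^m L_m. *)
Require Import Defs.
From Stdlib Require Import Reals Lra Lia Psatz Arith ZArith ClassicalEpsilon.
From Coquelicot Require Import Coquelicot.
Open Scope R_scope.

(** * Finite sums of reals, restated with the operations of [R] *)

Lemma sum_n_m_Sr (f : nat -> R) (n m : nat) :
  (n <= S m)%nat -> sum_n_m f n (S m) = sum_n_m f n m + f (S m).
Proof. intros H; exact (sum_n_Sm f n m H). Qed.

Lemma sum1_0 (f : nat -> R) : sum_n_m f 1 0 = 0.
Proof. apply (sum_n_m_zero f); lia. Qed.

Lemma sum_n_m_le_loc (f g : nat -> R) (n m : nat) :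
  (forall i, (n <= i <= m)%nat -> f i <= g i) -> sum_n_m f n m <= sum_n_m g n m.
Proof.
  induction m as [|m IH]; intros H.
  - destruct n; [rewrite !sum_n_n; apply H; lia|].
    rewrite !sum_n_m_zero by lia. lra.
  - destruct (le_lt_dec n (S m)).
    + rewrite !sum_n_m_Sr by lia. apply Rplus_le_compat.
      apply IH; intros; apply H; lia. apply H; lia.
    + rewrite !sum_n_m_zero by lia. lra.
Qed.

Lemma sum_n_m_Rabs (f : nat -> R) (n m : nat) :
  Rabs (sum_n_m f n m) <= sum_n_m (fun i => Rabs (f i)) n m.
Proof. exact (norm_sum_n_m f n m). Qed.

Lemma sum_n_m_Rplus (f g : nat -> R) (n m : nat) :
  sum_n_m (fun i => f i + g i) n m = sum_n_m f n m + sum_n_m g n m.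
Proof. exact (sum_n_m_plus f g n m). Qed.

Lemma sum_n_m_Rmult (c : R) (f : nat -> R) (n m : nat) :
  sum_n_m (fun i => c * f i) n m = c * sum_n_m f n m.
Proof. exact (sum_n_m_mult_l c f n m). Qed.

Lemma sum_n_m_Chasles_R (f : nat -> R) (n m p : nat) :
  (n <= S m)%nat -> (m <= p)%nat ->
  sum_n_m f n p = sum_n_m f n m + sum_n_m f (S m) p.
Proof. exact (sum_n_m_Chasles f n m p). Qed.

Lemma sum_n_m_pos (f : nat -> R) (n m : nat) :
  (forall i, (n <= i <= m)%nat -> 0 <= f i) -> 0 <= sum_n_m f n m.
Proof.
  intros H. apply Rle_trans with (sum_n_m (fun _ => 0) n m).
  - rewrite sum_n_m_const. lra.
  - now apply sum_n_m_le_loc.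
Qed.

Lemma sum_n_m_single (f : nat -> R) (e n m : nat) :
  (n <= e <= m)%nat -> (forall i, (n <= i <= m)%nat -> i <> e -> f i = 0) ->
  sum_n_m f n m = f e.
Proof.
  intros He H.
  assert (Z : forall p q, (n <= p)%nat -> (q <= m)%nat -> (q < e \/ e < p)%nat ->
    sum_n_m f p q = 0).
  { intros p q Hp Hq Hpq.
    rewrite (sum_n_m_ext_loc f (fun _ => 0)).
    - rewrite sum_n_m_const; lra.
    - intros i Hi; apply H; lia. }
  destruct e as [|e].
  - rewrite (sum_n_m_Chasles_R f n 0 m), (Z 1%nat m) by lia.
    replace n with 0%nat by lia. rewrite sum_n_n. lra.
  - rewrite (sum_n_m_Chasles_R f n (S e) m), sum_n_m_Sr by lia.
    rewrite (Z n e), (Z (S (S e)) m) by lia. lra.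
Qed.

(** * Arithmetic of k-free numbers *)

(** By Gauss's lemma a common divisor of [x * x ^ j] and [y], being coprime to [x], divides [x ^ j];
    so [P] raises one argument at a time, and symmetry of the gcd handles the other. *)
Lemma gcd_pow_coprime (k a b : nat) : Nat.gcd a b = 1%nat -> Nat.gcd (a ^ k) (b ^ k) = 1%nat.
Proof.
  assert (P : forall j x y, Nat.gcd x y = 1%nat -> Nat.gcd (x ^ j) y = 1%nat).
  { intros j x y H. induction j as [|j IH]; [reflexivity|].
    simpl. apply Nat.divide_1_r.
    assert (Hd := Nat.gcd_divide_l (x * x ^ j) y).
    assert (Hd2 := Nat.gcd_divide_r (x * x ^ j) y).
    set (g := Nat.gcd (x * x ^ j) y) in *.
    apply Nat.gauss in Hd.
    - rewrite <- IH. now apply Nat.gcd_greatest.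
    - apply Nat.divide_1_r. rewrite <- H. apply Nat.gcd_greatest.
      + apply Nat.gcd_divide_r.
      + eapply Nat.divide_trans; [apply Nat.gcd_divide_l|exact Hd2]. }
  intros H. apply P. rewrite Nat.gcd_comm. apply P. now rewrite Nat.gcd_comm.
Qed.

(** Once the gcd of [d] and [e] is divided out, [d' ^ k] is coprime to [e' ^ k] and so divides the
    k-free [m'], which forces [d' = 1]. Used in both directions, this gives uniqueness of [d] in
    [n = m * d ^ k]. *)
Lemma kfree_part_divide (k d e m m' : nat) :
  kfree k m' -> (0 < d)%nat -> (m * d ^ k = m' * e ^ k)%nat -> Nat.divide d e.
Proof.
  intros [_ F] Hd E.
  destruct (Nat.gcd_divide_l d e) as [d' Hd'].
  destruct (Nat.gcd_divide_r d e) as [e' He'].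
  assert (Hg : (Nat.gcd d e <> 0)%nat) by (intros Z; apply Nat.gcd_eq_0 in Z; lia).
  assert (Hc : Nat.gcd d' e' = 1%nat).
  { assert (H := Nat.gcd_mul_mono_r d' e' (Nat.gcd d e)).
    rewrite <- Hd', <- He' in H. nia. }
  set (g := Nat.gcd d e) in *.
  assert (D : Nat.divide (d' ^ k) (e' ^ k * m')).
  { exists m. apply Nat.mul_cancel_r with (g ^ k)%nat. now apply Nat.pow_nonzero.
    rewrite Hd', He' in E. rewrite !Nat.pow_mul_l in E. lia. }
  apply Nat.gauss in D; [|now apply gcd_pow_coprime].
  destruct (le_lt_dec d' 1) as [L|L].
  - exists e'. assert (d' = 1)%nat by nia. subst d'. rewrite Nat.mul_1_l in Hd'. now rewrite Hd'.
  - exfalso. exact (F d' L D).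
Qed.

(** Strong induction: a number that is not k-free loses a factor [d ^ k] with [d > 1]. The bound on
    [d] allows sums over [d] to run over a finite range. *)
Lemma kfree_part_exists (k n : nat) : (2 <= k)%nat -> (0 < n)%nat ->
  exists d m, (1 <= d <= n)%nat /\ n = (m * d ^ k)%nat /\ kfree k m.
Proof.
  intros Hk Hn. revert n Hn.
  apply (well_founded_induction lt_wf (fun n => (0 < n)%nat ->
    exists d m, (1 <= d <= n)%nat /\ n = (m * d ^ k)%nat /\ kfree k m)).
  intros n IH Hn.
  destruct (excluded_middle_informative (kfree k n)) as [F|F].
  - exists 1%nat, n. rewrite Nat.pow_1_l. repeat split; try lia; apply F.
  - assert (exists d, (1 < d)%nat /\ Nat.divide (d ^ k) n) as (d & Hd & q & Hq).
    { apply NNPP. intros G. apply F. split; [exact Hn|].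
      intros d Hd D. apply G. now exists d. }
    assert (Hp : (d < d ^ k)%nat).
    { replace d with (d ^ 1)%nat at 1 by apply Nat.pow_1_r. apply Nat.pow_lt_mono_r; lia. }
    destruct (IH q) as (e & m & He & E & Fm); [nia|nia|].
    exists (d * e)%nat, m. repeat split; try nia; try apply Fm.
    rewrite Nat.pow_mul_l. nia.
Qed.

Lemma mu_kfree_1 (k n : nat) : kfree k n -> mu_kfree k n = 1.
Proof. unfold mu_kfree. now destruct excluded_middle_informative. Qed.

Lemma mu_kfree_0 (k n : nat) : ~ kfree k n -> mu_kfree k n = 0.
Proof. unfold mu_kfree. now destruct excluded_middle_informative. Qed.

Lemma mu_kfree_bounds (k n : nat) : 0 <= mu_kfree k n <= 1.
Proof. unfold mu_kfree. destruct excluded_middle_informative; lra. Qed.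

(** Only the [d] of the unique decomposition [n = m * d ^ k] with [m] k-free contributes. The range
    [D] is separate from [n] so that it can stay fixed while [n] grows. *)
Lemma sum_mu_kfree_quotients (k n D : nat) : (2 <= k)%nat -> (0 < n <= D)%nat ->
  sum_n_m (fun d => if Nat.eq_dec (n mod d ^ k) 0 then mu_kfree k (n / d ^ k) else 0) 1 D = 1.
Proof.
  intros Hk Hn.
  destruct (kfree_part_exists k n Hk) as (e & m & He & E & Fm); [lia|].
  assert (He0 : (e ^ k <> 0)%nat) by (apply Nat.pow_nonzero; lia).
  rewrite (sum_n_m_single _ e); [|lia|].
  - destruct Nat.eq_dec as [Z|Z].
    + rewrite E, Nat.div_mul by assumption. now apply mu_kfree_1.
    + exfalso. apply Z. rewrite E. now apply Nat.Div0.mod_mul.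
  - intros d Hd Hne. destruct Nat.eq_dec as [Z|Z]; [|reflexivity].
    apply mu_kfree_0. intros F. apply Hne.
    assert (Hd0 : (d ^ k <> 0)%nat) by (apply Nat.pow_nonzero; lia).
    apply Nat.Div0.div_exact in Z.
    apply Nat.divide_antisym.
    + apply (kfree_part_divide k d e (n / d ^ k) m); [assumption|lia|lia].
    + apply (kfree_part_divide k e d m (n / d ^ k)); [assumption|lia|lia].
Qed.

Lemma div_succ_cases (n q : nat) : (0 < q)%nat ->
  (S n / q = if Nat.eq_dec (S n mod q) 0 then S (n / q) else n / q)%nat.
Proof.
  intros Hq.
  assert (H1 := Nat.div_mod_eq (S n) q). assert (H2 := Nat.div_mod_eq n q).
  assert (H3 := Nat.mod_upper_bound (S n) q ltac:(lia)).
  assert (H4 := Nat.mod_upper_bound n q ltac:(lia)).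
  destruct Nat.eq_dec; nia.
Qed.

(** Reindexing by [n = m * d ^ k]. From [N] to [S N] the inner sum for [d] gains a term exactly when
    [d ^ k] divides [S N], and the new terms add up to [w (S N)]. The weight 1 serves for counting,
    the weight [n ^ (- s)] for Dirichlet series. *)
Lemma sum_kfree_decomposition (k N D : nat) (w : nat -> R) :
  (2 <= k)%nat -> (N <= D)%nat ->
  sum_n_m w 1 N =
  sum_n_m (fun d => sum_n_m (fun m => mu_kfree k m * w (m * d ^ k)%nat) 1 (N / d ^ k)) 1 D.
Proof.
  intros Hk. induction N as [|N IH]; intros HN.
  - rewrite sum1_0. rewrite (sum_n_m_ext_loc _ (fun _ => 0)).
    + rewrite sum_n_m_const. lra.
    + intros d Hd. rewrite Nat.Div0.div_0_l. apply sum1_0.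
  - rewrite sum_n_m_Sr, IH by lia.
    rewrite <- (Rmult_1_r (w (S N))), <- (sum_mu_kfree_quotients k (S N) D) by lia.
    rewrite <- sum_n_m_Rmult, <- sum_n_m_Rplus.
    apply sum_n_m_ext_loc. intros d Hd.
    assert (Hq : (0 < d ^ k)%nat) by (assert (d ^ k <> 0)%nat by (apply Nat.pow_nonzero; lia); lia).
    assert (C := div_succ_cases N (d ^ k) Hq).
    destruct Nat.eq_dec as [Z|Z]; rewrite C; [|simpl; ring].
    rewrite sum_n_m_Sr by lia. apply Nat.Div0.div_exact in Z.
    rewrite <- C. rewrite (Nat.mul_comm (S N / d ^ k)), <- Z. simpl. ring.
Qed.

(** * Power sums and the zeta function *)

Lemma Rpower_pos (x p : R) : 0 < Rpower x p.
Proof. apply exp_pos. Qed.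

Lemma Rpower_antitone (x y p : R) : 0 < x <= y -> 0 <= p -> Rpower y (- p) <= Rpower x (- p).
Proof.
  intros Hxy Hp. rewrite !Rpower_Ropp. apply Rinv_le_contravar. apply Rpower_pos.
  apply Rle_Rpower_l; lra.
Qed.

Lemma Rpower_1_l (p : R) : Rpower 1 p = 1.
Proof. unfold Rpower. rewrite ln_1, Rmult_0_r. apply exp_0. Qed.

Lemma Rpower_div (x y p : R) : 0 < x -> 0 < y -> Rpower (x / y) p = Rpower x p * Rpower y (- p).
Proof.
  intros. unfold Rdiv.
  rewrite <- Rpower_mult_distr by (auto using Rinv_0_lt_compat). f_equal.
  unfold Rpower. rewrite ln_Rinv by assumption. f_equal. ring.
Qed.

Lemma is_derive_Rpower (x p : R) : 0 < x ->
  is_derive (fun t => Rpower t p) x (p * Rpower x (p - 1)).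
Proof.
  intros Hx. apply is_derive_Reals. now apply derivable_pt_lim_power.
Qed.

(** Mean value theorem: the derivative of [t ^ (- p)] is smallest in absolute value at the right end
    of the interval. Summation over integers then telescopes to the usual integral bound for
    tails. *)
Lemma Rpower_telescope (x p : R) : 0 < x -> 0 < p ->
  p * Rpower (x + 1) (- (1 + p)) <= Rpower x (- p) - Rpower (x + 1) (- p).
Proof.
  intros Hx Hp.
  destruct (MVT_gen (fun t => Rpower t (- p)) x (x + 1)
    (fun t => - p * Rpower t (- p - 1))) as (c & Hc & E).
  - intros t Ht. rewrite Rmin_left, Rmax_right in Ht by lra. apply is_derive_Rpower; lra.
  - intros t Ht. rewrite Rmin_left, Rmax_right in Ht by lra.
    apply derivable_continuous_pt. exists (- p * Rpower t (- p - 1)).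
    apply derivable_pt_lim_power; lra.
  - rewrite Rmin_left, Rmax_right in Hc by lra.
    assert (H := Rpower_antitone c (x + 1) (1 + p) ltac:(lra) ltac:(lra)).
    replace (- p - 1) with (- (1 + p)) in E by ring. nra.
Qed.

Lemma sum_Rpower_tail (p : R) (m N : nat) : 0 < p -> (1 <= m <= N)%nat ->
  sum_n_m (fun j => Rpower (INR j) (- (1 + p))) (S m) N
  <= (Rpower (INR m) (- p) - Rpower (INR N) (- p)) / p.
Proof.
  intros Hp [Hm HN]. induction HN as [|N HN IH].
  - rewrite sum_n_m_zero by lia. change zero with 0. unfold Rdiv. rewrite Rminus_diag. lra.
  - rewrite sum_n_m_Sr by lia.
    assert (HNpos : 0 < INR N) by (apply lt_0_INR; lia).
    assert (T := Rpower_telescope (INR N) p HNpos Hp). rewrite S_INR.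
    assert (Rpower (INR N + 1) (- (1 + p)) <= (Rpower (INR N) (- p) - Rpower (INR N + 1) (- p)) / p).
    { apply Rmult_le_reg_l with p; [assumption|]. field_simplify; [|lra]. lra. }
    unfold Rdiv in *. lra.
Qed.

Lemma sum_Rpower_tail_le (p : R) (m N : nat) : 0 < p -> (1 <= m)%nat ->
  sum_n_m (fun j => Rpower (INR j) (- (1 + p))) (S m) N <= Rpower (INR m) (- p) / p.
Proof.
  intros Hp Hm. assert (P := Rpower_pos (INR m) (- p)).
  assert (Q := Rpower_pos (INR N) (- p)). assert (Ip := Rinv_0_lt_compat p Hp).
  destruct (le_lt_dec m N).
  - eapply Rle_trans; [apply sum_Rpower_tail; [lra|lia]|]. unfold Rdiv. nra.
  - rewrite sum_n_m_zero by lia. change zero with 0. unfold Rdiv. nra.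
Qed.

(* 15/8 is twice the exponent 15/16 of the error term in [kfree_count_remainder]. *)
Lemma sum_Rpower_lt_1 (N : nat) :
  sum_n_m (fun d => Rpower (INR d) (- (15 / 8))) 2 N <= 91 / 100.
Proof.
  (* Here [t <= 11/10] because [(11/10) ^ 8 > 2]. The term [d = 2] is [t / 4] and the tail after it
     is at most [(t / 2) / (7 / 8) = 4 t / 7]; together [23 t / 28 < 91/100]. *)
  set (t := Rpower 2 (1 / 8)).
  assert (Ht0 : 0 < t) by apply Rpower_pos.
  assert (Ht : t <= 11 / 10).
  { apply Rnot_lt_le. intros L.
    assert (E : t ^ 8 = 2).
    { rewrite <- Rpower_pow by assumption. unfold t. rewrite Rpower_mult.
      replace (1 / 8 * INR 8) with 1 by (simpl; field). apply Rpower_1; lra. }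
    assert (121 / 100 <= t ^ 2) by (simpl; nra).
    assert (145 / 100 < t ^ 2 * t ^ 2) by nra.
    replace (t ^ 8) with ((t ^ 2 * t ^ 2) * (t ^ 2 * t ^ 2)) in E by ring.
    assert (2 < (t ^ 2 * t ^ 2) * (t ^ 2 * t ^ 2)) by nra. lra. }
  assert (E1 : Rpower 2 (- (15 / 8)) = t / 4).
  { unfold t. replace (- (15 / 8)) with (1 / 8 + - INR 2) by (simpl; field).
    rewrite Rpower_plus, Rpower_Ropp, Rpower_pow by lra. simpl. field. }
  assert (E2 : Rpower 2 (- (7 / 8)) = t / 2).
  { unfold t. replace (- (7 / 8)) with (1 / 8 + - (1)) by field.
    rewrite Rpower_plus, Rpower_Ropp, Rpower_1 by lra. field. }
  destruct (le_lt_dec 2 N) as [L|L].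
  - rewrite (sum_n_m_Chasles_R _ 2 2 N) by lia. rewrite sum_n_n.
    assert (T := sum_Rpower_tail_le (7 / 8) 2 N ltac:(lra) ltac:(lia)).
    replace (- (1 + 7 / 8)) with (- (15 / 8)) in T by field.
    change (INR 2) with 2 in *. rewrite E1. rewrite E2 in T. lra.
  - rewrite sum_n_m_zero by lia. change zero with 0. lra.
Qed.

Lemma is_series_C_Re_Im (a : nat -> C) (l : C) :
  is_series (V := C_NormedModule) a l ->
  is_series (fun n => Re (a n)) (Re l) /\ is_series (fun n => Im (a n)) (Im l).
Proof.
  intros H.
  assert (S : forall n, sum_n (G := C_AbelianMonoid) a n
    = (sum_n (fun n => Re (a n)) n, sum_n (fun n => Im (a n)) n)).
  { induction n as [|n IH]; [rewrite !sum_O; apply surjective_pairing|].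
    rewrite !sum_Sn, IH. reflexivity. }
  split; apply filterlim_locally; intros eps;
    generalize (proj1 (filterlim_locally (F := eventually) (U := C_NormedModule) (sum_n a) l) H eps);
    apply filter_imp; intros n [H1 H2]; rewrite S in H1, H2; assumption.
Qed.

Lemma nat_Cpow_RtoC (j : nat) (s : R) :
  nat_Cpow j (- RtoC s) = RtoC (Rpower (INR j) (- s)).
Proof.
  unfold nat_Cpow, Cexp. rewrite <- RtoC_opp, <- RtoC_mult. simpl.
  rewrite cos_0, sin_0. unfold Rpower, RtoC. f_equal; ring.
Qed.

Lemma sum_n_shift (f : nat -> R) (N : nat) :
  sum_n (fun n => f (S n)) N = sum_n_m f 1 (S N).
Proof. unfold sum_n. now rewrite sum_n_m_S. Qed.

(** The terms of the Dirichlet series are real for real [s], so the imaginary parts sum to 0. This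
    reduces the analysis to real sequences. *)
Lemma zeta_real (zeta : C -> C) (s : R) : is_riemann_zeta zeta -> 1 < s ->
  exists z, zeta (RtoC s) = RtoC z /\
    is_lim_seq (fun N => sum_n_m (fun j => Rpower (INR j) (- s)) 1 N) z.
Proof.
  intros [H _] Hs. specialize (H (RtoC s) Hs).
  apply is_series_C_Re_Im in H. destruct H as [HR HI].
  exists (Re (zeta (RtoC s))). split.
  - assert (E : Im (zeta (RtoC s)) = 0).
    { rewrite <- (is_series_unique _ _ HI).
      apply is_series_unique. apply is_series_ext with (fun _ => 0).
      - intros n. now rewrite nat_Cpow_RtoC.
      - apply filterlim_ext with (fun _ => 0).
        + intros n. rewrite sum_n_const. simpl; ring.
        + apply filterlim_const. }
    destruct (zeta (RtoC s)) as [u v]. simpl in E. now subst v.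
  - apply is_lim_seq_incr_1.
    apply is_lim_seq_ext with (sum_n (fun n => Re (nat_Cpow (S n) (- RtoC s)))); [|exact HR].
    intros N. rewrite <- sum_n_shift. apply sum_n_ext. intros n. now rewrite nat_Cpow_RtoC.
Qed.

Lemma sum1_incr (f : nat -> R) (n m : nat) : (forall j, 0 <= f j) -> (n <= m)%nat ->
  sum_n_m f 1 n <= sum_n_m f 1 m.
Proof.
  intros Hf H. rewrite (sum_n_m_Chasles_R f 1 n m) by lia.
  assert (P := sum_n_m_pos f (S n) m (fun i _ => Hf i)). lra.
Qed.

Lemma sum1_le_lim (f : nat -> R) (l : R) (n : nat) : (forall j, 0 <= f j) ->
  is_lim_seq (fun N => sum_n_m f 1 N) l -> sum_n_m f 1 n <= l.
Proof.
  intros Hf H. apply (is_lim_seq_incr_compare (fun N => sum_n_m f 1 N)); [assumption|].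
  intros m. apply sum1_incr; [assumption|lia].
Qed.

Lemma div_pow_lower (N d k : nat) (D : nat) : (d <= D)%nat -> (0 < d)%nat ->
  (N / D ^ k <= N / d ^ k)%nat.
Proof.
  intros. apply Nat.div_le_compat_l. split.
  - assert (d ^ k <> 0)%nat by (apply Nat.pow_nonzero; lia). lia.
  - now apply Nat.pow_le_mono_l.
Qed.

Lemma Rpower_mult_pow (m d k : nat) (s : R) : (0 < m)%nat -> (0 < d)%nat ->
  Rpower (INR (m * d ^ k)) (- s) = Rpower (INR d) (- (INR k * s)) * Rpower (INR m) (- s).
Proof.
  intros Hm Hd. apply lt_0_INR in Hm, Hd.
  rewrite mult_INR, pow_INR, <- Rpower_mult_distr, <- Rpower_pow, Rpower_mult
    by auto using pow_lt.
  replace (INR k * - s) with (- (INR k * s)) by ring. ring.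
Qed.

(** All terms are nonnegative, so the k-free series converges by domination, and the product formula
    follows from two inequalities between partial sums. *)
Lemma kfree_dirichlet_series (k : nat) (s z zk : R) : (2 <= k)%nat ->
  is_lim_seq (fun N => sum_n_m (fun j => Rpower (INR j) (- s)) 1 N) z ->
  is_lim_seq (fun N => sum_n_m (fun j => Rpower (INR j) (- (INR k * s))) 1 N) zk ->
  exists F : R, is_lim_seq (fun N => sum_n_m (fun m => mu_kfree k m * Rpower (INR m) (- s)) 1 N) F
    /\ z = zk * F.
Proof.
  intros Hk Hz Hzk.
  set (f := fun m => mu_kfree k m * Rpower (INR m) (- s)).
  set (g := fun j => Rpower (INR j) (- s)) in *.
  set (h := fun j => Rpower (INR j) (- (INR k * s))) in *.
  assert (Hf : forall j, 0 <= f j).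
  { intros j. apply Rmult_le_pos; [apply mu_kfree_bounds|apply Rlt_le, Rpower_pos]. }
  assert (Hg : forall j, 0 <= g j) by (intros; apply Rlt_le, Rpower_pos).
  assert (Hh : forall j, 0 <= h j) by (intros; apply Rlt_le, Rpower_pos).
  destruct (ex_finite_lim_seq_incr (fun N => sum_n_m f 1 N) z) as [F HF].
  { intros n. now apply sum1_incr; [|lia]. }
  { intros n. apply Rle_trans with (sum_n_m g 1 n); [|now apply sum1_le_lim].
    apply sum_n_m_le_loc. intros i _. unfold f.
    assert (B := mu_kfree_bounds k i). specialize (Hg i). unfold g in *. nra. }
  exists F. split; [exact HF|].
  assert (D : forall N E, (N <= E)%nat ->
    sum_n_m g 1 N = sum_n_m (fun d => h d * sum_n_m f 1 (N / d ^ k)) 1 E).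
  { intros N E HN. rewrite (sum_kfree_decomposition k N E g Hk HN).
    apply sum_n_m_ext_loc. intros d Hd. rewrite <- sum_n_m_Rmult.
    apply sum_n_m_ext_loc. intros m Hm. unfold g, h, f.
    rewrite Rpower_mult_pow by lia. simpl. ring. }
  assert (HF0 : forall n, sum_n_m f 1 n <= F) by (intros; now apply sum1_le_lim).
  assert (F0 : 0 <= F) by (rewrite <- (sum1_0 f); apply HF0).
  apply Rle_antisym.
  - apply (is_lim_seq_le (fun N => sum_n_m g 1 N) (fun _ => zk * F) z (zk * F));
      [|assumption|apply is_lim_seq_const].
    intros N. rewrite (D N N) by lia.
    apply Rle_trans with (sum_n_m (fun d => F * h d) 1 N).
    + apply sum_n_m_le_loc. intros d _. specialize (HF0 (N / d ^ k)%nat). specialize (Hh d). nra.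
    + rewrite sum_n_m_Rmult. assert (L := sum1_le_lim h zk N Hh Hzk). nra.
  (* With cut-off [E * E ^ k], every [d <= E] has quotient at least [E], so the product of the two
     partial sums up to [E] is contained in a partial sum for [z]. *)
  - assert (Hsq : forall E, sum_n_m h 1 E * sum_n_m f 1 E <= z).
    { intros E. eapply Rle_trans; [|apply (sum1_le_lim g z (E * E ^ k) Hg Hz)].
      rewrite (D (E * E ^ k)%nat (E + E * E ^ k)%nat) by lia.
      apply Rle_trans with (sum_n_m (fun d => h d * sum_n_m f 1 (E * E ^ k / d ^ k)) 1 E).
      - rewrite (Rmult_comm (sum_n_m h 1 E)), <- sum_n_m_Rmult. apply sum_n_m_le_loc. intros d Hd.
        rewrite Rmult_comm. apply Rmult_le_compat_l; [apply Hh|].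
        apply sum1_incr; [assumption|].
        eapply Nat.le_trans; [|apply (div_pow_lower _ d k E); lia].
        rewrite Nat.div_mul; [lia|apply Nat.pow_nonzero; lia].
      - apply (sum1_incr (fun d => h d * sum_n_m f 1 (E * E ^ k / d ^ k))); [|lia].
        intros j. apply Rmult_le_pos; [apply Hh|]. now apply sum_n_m_pos. }
    apply (is_lim_seq_le (fun E => sum_n_m h 1 E * sum_n_m f 1 E) (fun _ => z) (zk * F) z);
      [assumption| |apply is_lim_seq_const].
    now apply (is_lim_seq_mult' _ _ zk F).
Qed.

(** * Counting k-free numbers *)

Lemma INR_div_bounds (N q : nat) : (0 < q)%nat ->
  INR (N / q) <= INR N / INR q < INR (N / q) + 1.
Proof.
  intros Hq. assert (H := Nat.div_mod_eq N q).
  assert (B := Nat.mod_upper_bound N q ltac:(lia)).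
  apply (f_equal INR) in H. rewrite plus_INR, mult_INR in H.
  apply lt_INR in B. assert (P := pos_INR (N mod q)). apply lt_0_INR in Hq.
  assert (E : INR N / INR q = INR (N / q) + INR (N mod q) / INR q) by (rewrite H; field; lra).
  assert (0 <= INR (N mod q) / INR q) by (apply Rdiv_le_0_compat; lra).
  assert (INR (N mod q) / INR q < 1) by (apply Rlt_div_l; lra).
  lra.
Qed.

Lemma Rpower_ge_1 (x p : R) : 1 <= x -> 0 <= p -> 1 <= Rpower x p.
Proof.
  intros Hx Hp. rewrite <- (Rpower_O x) by lra. apply Rle_Rpower; lra.
Qed.

Lemma Rpower_small (x p : R) : 0 < x <= 1 -> p <= 1 -> x <= Rpower x p.
Proof.
  intros Hx Hp. assert (H := Rpower_ge_1 (/ x) (1 - p)).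
  unfold Rpower in *. rewrite <- (exp_ln x) at 1 by lra.
  apply Rnot_lt_le. intros L. apply exp_lt_inv in L.
  assert (ln x <= ln 1) by (destruct (Req_dec x 1) as [->|]; [lra|apply Rlt_le, ln_increasing; lra]).
  rewrite ln_1 in *. nra.
Qed.

(** Replaces [d ^ (- k p)] by [d ^ (- 2 p)], which makes the exponents of the counting estimates
    independent of [k]. *)
Lemma div_pow_Rpower (N d k : nat) (p : R) : (1 <= N)%nat -> (1 <= d)%nat -> (2 <= k)%nat -> 0 <= p ->
  Rpower (INR N / INR (d ^ k)) p <= Rpower (INR N) p * Rpower (INR d) (- (2 * p)).
Proof.
  intros HN Hd Hk Hp.
  assert (Hd1 : 1 <= INR d) by (apply (le_INR 1); lia).
  assert (HN1 : 1 <= INR N) by (apply (le_INR 1); lia).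
  rewrite pow_INR. assert (0 < INR d ^ k) by (apply pow_lt; lra).
  rewrite Rpower_div, <- Rpower_pow, Rpower_mult by lra.
  apply Rmult_le_compat_l; [apply Rlt_le, Rpower_pos|].
  apply Rle_Rpower; [assumption|]. apply (le_INR 2) in Hk. simpl in Hk. nra.
Qed.

(** The k-free counts up to the quotients [N / d ^ k] add up to exactly [N], and the quotients
    themselves add up to [N z] within [1 + 191/100 * N ^ (15/16)]. Since [z >= 1], the summed errors
    stay below [3 N ^ (15/16)]. *)
Lemma kfree_count_quotients (k N : nat) (z : R) : (2 <= k)%nat -> (1 <= N)%nat ->
  is_lim_seq (fun N => sum_n_m (fun j => Rpower (INR j) (- INR k)) 1 N) z ->
  1 <= z /\
  Rabs (sum_n_m (fun d => sum_n_m (mu_kfree k) 1 (N / d ^ k) - INR (N / d ^ k) / z) 1 N)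
    <= 3 * Rpower (INR N) (15 / 16).
Proof.
  intros Hk HN Hz.
  set (h := fun j => Rpower (INR j) (- INR k)) in *.
  assert (Hh : forall j, 0 <= h j) by (intros; apply Rlt_le, Rpower_pos).
  assert (Hz1 : 1 <= z).
  { assert (L := sum1_le_lim h z 1 Hh Hz). rewrite sum_n_n in L.
    unfold h in L. now rewrite Rpower_1_l in L. }
  split; [exact Hz1|].
  assert (HN1 : 1 <= INR N) by (apply (le_INR 1); lia).
  assert (Hq : forall d, (1 <= d)%nat -> (0 < d ^ k)%nat).
  { intros d Hd. assert (d ^ k <> 0)%nat by (apply Nat.pow_nonzero; lia). lia. }
  assert (Hinv : forall d, (1 <= d)%nat -> INR N / INR (d ^ k) = INR N * h d).
  { intros d Hd. unfold h. rewrite Rpower_Ropp, Rpower_pow, pow_INR by (apply lt_0_INR; lia).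
    reflexivity. }
  assert (E : sum_n_m (fun d => sum_n_m (mu_kfree k) 1 (N / d ^ k) - INR (N / d ^ k) / z) 1 N
    = INR N - / z * sum_n_m (fun d => INR (N / d ^ k)) 1 N).
  { assert (D := sum_kfree_decomposition k N N (fun _ => 1) Hk (le_n _)).
    rewrite sum_n_m_const in D. replace (S N - 1)%nat with N in D by lia.
    rewrite Rmult_1_r in D. rewrite D.
    unfold Rminus.
    rewrite Ropp_mult_distr_l, <- sum_n_m_Rmult, <- sum_n_m_Rplus.
    apply sum_n_m_ext_loc. intros d _. f_equal.
    - apply sum_n_m_ext_loc. intros; simpl; ring.
    - unfold Rdiv. ring. }
  assert (U : sum_n_m (fun d => INR (N / d ^ k)) 1 N <= INR N * z).
  { apply Rle_trans with (sum_n_m (fun d => INR N * h d) 1 N).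
    - apply sum_n_m_le_loc. intros d Hd. rewrite <- Hinv by lia.
      apply INR_div_bounds, Hq. lia.
    - rewrite sum_n_m_Rmult. assert (L := sum1_le_lim h z N Hh Hz). nra. }
  (* The tail of [z] beyond [N] is at most the sum of [j ^ (- 2)] over [j > N], hence at most
     [1 / N]. *)
  assert (T : z <= sum_n_m h 1 N + / INR N).
  { apply (is_lim_seq_le (fun M => sum_n_m h 1 M) (fun _ => sum_n_m h 1 N + / INR N) z
      (sum_n_m h 1 N + / INR N)); [|assumption|apply is_lim_seq_const].
    intros M. destruct (le_lt_dec M N) as [L|L].
    - assert (Q := sum1_incr h M N Hh L).
      assert (0 < / INR N) by (apply Rinv_0_lt_compat; lra). lra.
    - rewrite (sum_n_m_Chasles_R h 1 N M) by lia. apply Rplus_le_compat_l.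
      apply Rle_trans with (sum_n_m (fun j => Rpower (INR j) (- (1 + 1))) (S N) M).
      + apply sum_n_m_le_loc. intros i Hi. apply Rle_Rpower.
        * apply (le_INR 1); lia.
        * apply (le_INR 2) in Hk. simpl in Hk. lra.
      + eapply Rle_trans; [apply sum_Rpower_tail_le; [lra|lia]|].
        rewrite Rpower_Ropp, Rpower_1 by lra. lra. }
  (* Rounding [y = N / d ^ k] down costs at most [y ^ (15/16)]: for [y >= 1] the loss is below 1,
     for [y < 1] it is at most [y]. Summed over [d], the term [d = 1] gives 1 and the others at most
     [91/100]. *)
  assert (V : INR N * sum_n_m h 1 N - 191 / 100 * Rpower (INR N) (15 / 16)
    <= sum_n_m (fun d => INR (N / d ^ k)) 1 N).
  { apply Rle_trans with (sum_n_m (fun d => INR N * h d +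
      (- Rpower (INR N) (15 / 16)) * Rpower (INR d) (- (15 / 8))) 1 N).
    - rewrite sum_n_m_Rplus, !sum_n_m_Rmult.
      rewrite (sum_n_m_Chasles_R (fun d => Rpower (INR d) (- (15 / 8))) 1 1 N), sum_n_n by lia.
      change (INR 1) with 1. rewrite Rpower_1_l.
      assert (Q := sum_Rpower_lt_1 N). assert (P := Rpower_pos (INR N) (15 / 16)). nra.
    - apply sum_n_m_le_loc. intros d Hd.
      assert (Q := div_pow_Rpower N d k (15 / 16) HN ltac:(lia) Hk ltac:(lra)).
      replace (2 * (15 / 16)) with (15 / 8) in Q by field.
      rewrite <- Hinv by lia.
      assert (B := INR_div_bounds N (d ^ k) (Hq d ltac:(lia))).
      set (y := INR N / INR (d ^ k)) in *.
      assert (y <= INR (N / d ^ k) + Rpower y (15 / 16)); [|lra].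
      destruct (Rle_lt_dec 1 y) as [L|L].
      + assert (G := Rpower_ge_1 y (15 / 16) L ltac:(lra)). lra.
      + assert (0 < y).
        { apply Rdiv_lt_0_compat; [lra|]. apply lt_0_INR, Hq. lia. }
        assert (G := Rpower_small y (15 / 16) ltac:(lra) ltac:(lra)).
        assert (P := pos_INR (N / d ^ k)). lra. }
  rewrite E. set (s := sum_n_m (fun d => INR (N / d ^ k)) 1 N) in *.
  set (t := Rpower (INR N) (15 / 16)) in *.
  assert (Ht : 1 <= t) by (apply Rpower_ge_1; lra).
  assert (Iz : / z <= 1) by (rewrite <- Rinv_1; apply Rinv_le_contravar; lra).
  assert (Iz0 : 0 < / z) by (apply Rinv_0_lt_compat; lra).
  assert (W : INR N * z - 1 - 191 / 100 * t <= s).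
  { assert (INR N * z <= INR N * sum_n_m h 1 N + 1); [|lra].
    assert (INR N * / INR N = 1) by (field; lra). nra. }
  assert (W1 : / z * s <= INR N).
  { replace (INR N) with (/ z * (INR N * z)) by (field; lra).
    apply Rmult_le_compat_l; lra. }
  assert (W2 : / z * (INR N * z - 1 - 191 / 100 * t) <= / z * s)
    by (apply Rmult_le_compat_l; lra).
  replace (/ z * (INR N * z - 1 - 191 / 100 * t)) with
    (INR N - / z * (1 + 191 / 100 * t)) in W2 by (field; lra).
  rewrite Rabs_right by lra. nra.
Qed.

(* Each N counts itself as N = sum_d A(N/d^k), so the error term at N is controlled by the
   errors at N/d^k with d >= 2; the recursion closes since sum_(d >= 2) d^(-15/8) < 1. *)
Lemma kfree_count_remainder (k : nat) (z : R) : (2 <= k)%nat ->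
  is_lim_seq (fun N => sum_n_m (fun j => Rpower (INR j) (- INR k)) 1 N) z ->
  forall N, (1 <= N)%nat ->
  Rabs (sum_n_m (mu_kfree k) 1 N - INR N / z) <= 100 * Rpower (INR N) (15 / 16).
Proof.
  intros Hk Hz.
  set (r := fun N => sum_n_m (mu_kfree k) 1 N - INR N / z).
  apply (well_founded_induction lt_wf (fun N => (1 <= N)%nat ->
    Rabs (r N) <= 100 * Rpower (INR N) (15 / 16))).
  intros N IH HN.
  destruct (kfree_count_quotients k N z Hk HN Hz) as [Hz1 B].
  change (Rabs (sum_n_m (fun d => r (N / d ^ k)%nat) 1 N) <= 3 * Rpower (INR N) (15 / 16)) in B.
  (* The term [d = 1] is [r N]. With the constant 100 in the induction hypothesis the other terms
     contribute at most 91, and [3 + 91 <= 100]. *)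
  rewrite (sum_n_m_Chasles_R _ 1 1 N), sum_n_n, Nat.pow_1_l, Nat.div_1_r in B by lia.
  assert (T : Rabs (sum_n_m (fun d => r (N / d ^ k)%nat) 2 N)
    <= 91 * Rpower (INR N) (15 / 16)).
  { eapply Rle_trans; [apply sum_n_m_Rabs|].
    apply Rle_trans with (sum_n_m (fun d => 100 * Rpower (INR N) (15 / 16) *
      Rpower (INR d) (- (15 / 8))) 2 N).
    - apply sum_n_m_le_loc. intros d Hd.
      assert (P1 := Rpower_pos (INR N) (15 / 16)). assert (P2 := Rpower_pos (INR d) (- (15 / 8))).
      assert (Hdk : (2 <= d ^ k)%nat).
      { apply Nat.le_trans with (2 ^ 1)%nat; [simpl; lia|].
        apply Nat.le_trans with (2 ^ k)%nat; [apply Nat.pow_le_mono_r; lia|].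
        apply Nat.pow_le_mono_l; lia. }
      (* The induction hypothesis starts at 1; for a zero quotient [r 0 = 0] directly. *)
      destruct (Nat.eq_dec (N / d ^ k) 0) as [E|E].
      + rewrite E. unfold r. rewrite sum1_0. simpl. unfold Rdiv.
        rewrite Rmult_0_l, Rminus_0_r, Rabs_R0. nra.
      + eapply Rle_trans; [apply IH; [apply Nat.div_lt; lia|lia]|].
        rewrite Rmult_assoc. apply Rmult_le_compat_l; [lra|].
        assert (Q := div_pow_Rpower N d k (15 / 16) HN ltac:(lia) Hk ltac:(lra)).
        replace (2 * (15 / 16)) with (15 / 8) in Q by field.
        eapply Rle_trans; [|exact Q]. apply Rle_Rpower_l; [lra|]. split.
        * apply lt_0_INR. lia.
        * apply INR_div_bounds. lia.
    - rewrite sum_n_m_Rmult. assert (Q := sum_Rpower_lt_1 N).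
      assert (P := Rpower_pos (INR N) (15 / 16)). nra. }
  assert (P := Rpower_pos (INR N) (15 / 16)).
  apply Rabs_le_between in B, T. apply Rabs_le. lra.
Qed.

(** * Regularized sums *)

Lemma is_lim_Rpower_neg (p : R) : 0 < p -> is_lim (fun x => Rpower x (- p)) p_infty 0.
Proof.
  intros Hp. apply is_lim_spec. intros eps. exists (Rpower eps (- / p)). intros x Hx.
  assert (He := cond_pos eps). assert (P := Rpower_pos eps (- / p)).
  assert (Q := Rpower_pos x (- p)).
  rewrite Rminus_0_r, Rabs_right by lra.
  replace (pos eps) with (Rpower (Rpower eps (- / p)) (- p)).
  - unfold Rpower at 1 2. apply exp_increasing.
    assert (L := ln_increasing _ _ P Hx). nra.
  - rewrite Rpower_mult. replace (- / p * - p) with 1 by (field; lra). now apply Rpower_1.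
Qed.

Lemma is_lim_seq_Rpower_neg (p : R) : 0 < p -> is_lim_seq (fun n => Rpower (INR n) (- p)) 0.
Proof.
  intros Hp. apply (is_lim_comp_seq (fun x => Rpower x (- p)) INR p_infty 0).
  - now apply is_lim_Rpower_neg.
  - now exists 0%nat.
  - apply is_lim_seq_INR.
Qed.

(** The series of increments converges absolutely, and its sum, of size at most [T], is the distance
    from the first value to the limit. *)
Lemma is_lim_seq_summable_increments (u b : nat -> R) (T : R) :
  (forall n, Rabs (u (S n) - u n) <= b (S n)) ->
  (forall N, sum_n_m b 1 N <= T) ->
  exists L : R, is_lim_seq u L /\ Rabs (L - u 0%nat) <= T.
Proof.
  intros Hu Hb. set (d := fun n => u (S n) - u n).
  assert (B : forall n, sum_n (fun n => Rabs (d n)) n <= T).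
  { intros n. eapply Rle_trans; [|apply (Hb (S n))].
    rewrite <- sum_n_shift. apply sum_n_m_le. intros i. apply Hu. }
  assert (E : ex_series (fun n => Rabs (d n))).
  { apply (ex_finite_lim_seq_incr (sum_n (fun n => Rabs (d n))) T).
    - intros n. rewrite sum_Sn. assert (H := Rabs_pos (d (S n))).
      change (sum_n (fun n => Rabs (d n)) n <= sum_n (fun n => Rabs (d n)) n + Rabs (d (S n))).
      lra.
    - exact B. }
  destruct (ex_series_Rabs d E : exists s : R, is_series d s) as [s Hs].
  assert (D : forall n, sum_n d n = u (S n) - u 0%nat).
  { induction n as [|n IH]; [now rewrite sum_O|]. rewrite sum_Sn, IH.
    unfold d, plus; simpl. ring. }
  assert (L : is_lim_seq u (u 0%nat + s)).
  { apply is_lim_seq_incr_1. apply is_lim_seq_ext with (fun n => u 0%nat + sum_n d n).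
    - intros n. rewrite D. ring.
    - apply (is_lim_seq_plus' (fun _ => u 0%nat) (sum_n d) (u 0%nat) s);
        [apply is_lim_seq_const|exact Hs]. }
  exists (u 0%nat + s). split; [exact L|].
  apply (is_lim_seq_le (fun n => Rabs (sum_n d n)) (fun _ => T) (Rabs (u 0%nat + s - u 0%nat)) T).
  - intros n. eapply Rle_trans; [|apply B]. exact (sum_n_m_Rabs d 0 n).
  - replace (u 0%nat + s - u 0%nat) with s by ring. exact (is_lim_seq_abs (sum_n d) s Hs).
  - apply is_lim_seq_const.
Qed.

Lemma MVT_le (f f' : R -> R) (x y B : R) : x <= y ->
  (forall t, x <= t <= y -> is_derive f t (f' t)) ->
  (forall t, x <= t <= y -> Rabs (f' t) <= B) ->
  Rabs (f y - f x) <= B * (y - x).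
Proof.
  intros Hxy D HB. destruct (MVT_gen f x y f') as (c & Hc & ->).
  - intros t Ht. rewrite Rmin_left, Rmax_right in Ht by lra. apply D; lra.
  - intros t Ht. rewrite Rmin_left, Rmax_right in Ht by lra.
    apply derivable_continuous_pt. exists (f' t). apply is_derive_Reals, D; lra.
  - rewrite Rmin_left, Rmax_right in Hc by lra.
    rewrite Rabs_mult, (Rabs_right (y - x)) by lra.
    apply Rmult_le_compat_r; [lra|]. now apply HB.
Qed.

(* [Phi] is meant to be the antiderivative of [phi] on [1, +oo) vanishing at 1. *)
Definition regularized_sum (a : nat -> R) (c : R) (phi Phi : R -> R) (N : nat) : R :=
  sum_n_m (fun j => a j * phi (INR j)) 1 N - c * Phi (INR N).

(* Any exponents [b] and [1 + b] with [15/16 < b < 1] would do: powers of the logarithm cost an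
   arbitrarily small power, and [x^(15/16 - (1 + b))] must be summable. *)
Record slowly_decaying (M : R) (phi Phi : R -> R) : Prop := {
  sd_antiderivative : forall x, 1 <= x -> is_derive Phi x (phi x);
  sd_zero : Phi 1 = 0;
  sd_bound : forall x, 1 <= x -> Rabs (phi x) <= M * Rpower x (- (31 / 32));
  sd_derivative : exists phi', forall x, 1 <= x ->
    is_derive phi x (phi' x) /\ Rabs (phi' x) <= M * Rpower x (- (63 / 32)) }.

Lemma slowly_decaying_nonneg (M : R) (phi Phi : R -> R) : slowly_decaying M phi Phi -> 0 <= M.
Proof.
  intros [_ _ B _]. specialize (B 1 (Rle_refl 1)). rewrite Rpower_1_l in B.
  assert (P := Rabs_pos (phi 1)). lra.
Qed.

(* Summation by parts: removing the boundary term leaves increments of size N^(15/16 - 63/32). *)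
Lemma regularized_sum_lim (a : nat -> R) (c K : R) : 0 <= K ->
  (forall N, (1 <= N)%nat ->
    Rabs (sum_n_m a 1 N - c * INR N) <= K * Rpower (INR N) (15 / 16)) ->
  exists C0, forall M phi Phi, slowly_decaying M phi Phi ->
    exists L : R, is_lim_seq (regularized_sum a c phi Phi) L /\ Rabs L <= C0 * M.
Proof.
  (* The number 33 = 1 + 32 bounds the sum of [j ^ (- 33/32)]; the last [Rabs c] accounts for the
     starting value [c * phi 1]. The constant is fixed before [phi], so it is uniform over families
     of test functions. *)
  intros HK Hr. exists ((K + Rabs c) * 33 + Rabs c).
  intros M phi Phi SD. assert (HM := slowly_decaying_nonneg _ _ _ SD).
  destruct SD as [D1 HP B1 (phi' & D2)].
  set (r := fun N => sum_n_m a 1 N - c * INR N) in *.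
  set (U := fun N => regularized_sum a c phi Phi N - r N * phi (INR N)).
  assert (HU : forall n, Rabs (U (S (S n)) - U (S n))
    <= (K + Rabs c) * M * Rpower (INR (S n)) (- (1 + 1 / 32))).
  { intros n. set (N := S n).
    assert (HN : 1 <= INR N) by (apply (le_INR 1); unfold N; lia).
    assert (V : forall x y, INR N <= x -> x <= y <= INR N + 1 ->
      Rabs (phi y - phi x) <= M * Rpower (INR N) (- (63 / 32))).
    { intros x y Hx Hy.
      assert (Q := Rpower_pos (INR N) (- (63 / 32))).
      eapply Rle_trans; [apply (MVT_le phi phi' x y (M * Rpower (INR N) (- (63 / 32))))|].
      - lra.
      - intros t Ht. apply D2. lra.
      - intros t Ht. eapply Rle_trans; [apply D2; lra|].
        apply Rmult_le_compat_l; [assumption|]. apply Rpower_antitone; lra.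
      - assert (0 <= M * Rpower (INR N) (- (63 / 32))) by (apply Rmult_le_pos; lra).
        rewrite <- (Rmult_1_r (M * _)) at 2. apply Rmult_le_compat_l; lra. }
    assert (W : Rabs (phi (INR N + 1) - (Phi (INR N + 1) - Phi (INR N)))
      <= M * Rpower (INR N) (- (63 / 32))).
    { destruct (MVT_gen Phi (INR N) (INR N + 1) phi) as (x & Hx & E).
      - intros t Ht. rewrite Rmin_left, Rmax_right in Ht by lra. apply D1; lra.
      - intros t Ht. rewrite Rmin_left, Rmax_right in Ht by lra.
        apply derivable_continuous_pt. exists (phi t). apply is_derive_Reals, D1; lra.
      - rewrite Rmin_left, Rmax_right in Hx by lra. rewrite E.
        replace (INR N + 1 - INR N) with 1 by ring. rewrite Rmult_1_r. apply V; lra. }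
    (* Abel summation: the increment is [r N] times a difference of [phi], plus [c] times the error
       of replacing the integral over one unit interval by the value at its right end. *)
    assert (E : U (S N) - U N = - r N * (phi (INR N + 1) - phi (INR N))
      + c * (phi (INR N + 1) - (Phi (INR N + 1) - Phi (INR N)))).
    { unfold U, regularized_sum, r. rewrite !sum_n_m_Sr, S_INR by lia. ring. }
    change (S (S n)) with (S N). rewrite E.
    assert (G := V (INR N) (INR N + 1) ltac:(lra) ltac:(lra)).
    specialize (Hr N ltac:(unfold N; lia)).
    eapply Rle_trans; [apply Rabs_triang|]. rewrite !Rabs_mult, Rabs_Ropp.
    replace ((K + Rabs c) * M * Rpower (INR N) (- (1 + 1 / 32))) with
      (K * Rpower (INR N) (15 / 16) * (M * Rpower (INR N) (- (63 / 32)))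
       + Rabs c * (M * Rpower (INR N) (- (1 + 1 / 32)))).
    2: { replace (- (1 + 1 / 32)) with (15 / 16 + - (63 / 32)) by field.
         rewrite Rpower_plus. ring. }
    apply Rplus_le_compat.
    - apply Rmult_le_compat; auto using Rabs_pos.
    - apply Rmult_le_compat_l; [apply Rabs_pos|]. eapply Rle_trans; [exact W|].
      apply Rmult_le_compat_l; [assumption|]. apply Rle_Rpower; lra. }
  set (B := (K + Rabs c) * M) in *.
  assert (HB : 0 <= B) by (apply Rmult_le_pos; [assert (P := Rabs_pos c); lra|lra]).
  (* The sequence starts at [N = 1] because [phi] and [Phi] are controlled only on [x >= 1]. *)
  destruct (is_lim_seq_summable_increments (fun n => U (S n))
    (fun j => B * Rpower (INR j) (- (1 + 1 / 32))) (B * 33) HU) as (L & HL & HL0).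
  { intros N. rewrite sum_n_m_Rmult. apply Rmult_le_compat_l; [assumption|].
    destruct N as [|N]; [rewrite sum1_0; lra|].
    rewrite (sum_n_m_Chasles_R _ 1 1 (S N)), sum_n_n by lia.
    assert (T := sum_Rpower_tail_le (1 / 32) 1 (S N) ltac:(lra) ltac:(lia)).
    change (INR 1) with 1 in *. rewrite Rpower_1_l in *. lra. }
  exists L. split.
  (* The boundary term is put back: it is of size [N ^ (15/16 - 31/32) = N ^ (- 1/32)] and does not
     change the limit. *)
  - apply is_lim_seq_incr_1.
    apply is_lim_seq_ext with (fun n => U (S n) + r (S n) * phi (INR (S n))).
    { intros n. unfold U. ring. }
    replace (Finite L) with (Finite (L + 0)) by (f_equal; ring).
    apply is_lim_seq_plus'; [exact HL|].
    apply is_lim_seq_abs_0.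
    apply (is_lim_seq_le_le (fun _ => 0) _
      (fun n => K * M * Rpower (INR (S n)) (- (1 / 32))) 0).
    + intros n. split; [apply Rabs_pos|]. rewrite Rabs_mult.
      assert (1 <= INR (S n)) by (apply (le_INR 1); lia).
      replace (- (1 / 32)) with (15 / 16 + - (31 / 32)) by field. rewrite Rpower_plus.
      replace (K * M * (Rpower (INR (S n)) (15 / 16) * Rpower (INR (S n)) (- (31 / 32))))
        with (K * Rpower (INR (S n)) (15 / 16) * (M * Rpower (INR (S n)) (- (31 / 32)))) by ring.
      apply Rmult_le_compat; auto using Rabs_pos. apply Hr. lia.
    + apply is_lim_seq_const.
    + replace (Finite 0) with (Rbar_mult (K * M) 0) by (simpl; f_equal; ring).
      apply is_lim_seq_scal_l.
      apply (is_lim_seq_incr_1 (fun n => Rpower (INR n) (- (1 / 32)))).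
      apply is_lim_seq_Rpower_neg. lra.
  - assert (E : U 1%nat = c * phi 1).
    { unfold U, regularized_sum, r. rewrite !sum_n_n. change (INR 1) with 1. rewrite HP. ring. }
    rewrite E in HL0. specialize (B1 1 (Rle_refl 1)). rewrite Rpower_1_l, Rmult_1_r in B1.
    replace L with (L - c * phi 1 + c * phi 1) by ring.
    eapply Rle_trans; [apply Rabs_triang|]. rewrite (Rabs_mult c).
    assert (Q := Rmult_le_compat_l _ _ _ (Rabs_pos c) B1). unfold B in HL0. lra.
Qed.

(** * Logarithmic weights and the expansion at the pole *)

(** Each factor [y] is paid for by half of the exponent, as [p / 2 * y <= exp (p / 2 * y)]. With
    [p = 1/32] and [y = ln x], powers of the logarithm are absorbed into [x ^ (1/32)]. *)
Lemma pow_le_exp (p : R) (m : nat) : 0 < p ->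
  exists M, 0 <= M /\ forall y, 0 <= y -> y ^ m <= M * exp (p * y).
Proof.
  revert p. induction m as [|m IH]; intros p Hp.
  - exists 1. split; [lra|]. intros y Hy. simpl.
    assert (H := exp_ineq1_le (p * y)). nra.
  - destruct (IH (p / 2)) as (M & HM & H); [lra|].
    exists (2 / p * M). split; [apply Rmult_le_pos; [apply Rdiv_le_0_compat|]; lra|].
    intros y Hy. simpl. specialize (H y Hy).
    assert (G := exp_ineq1_le (p / 2 * y)).
    replace (p * y) with (p / 2 * y + p / 2 * y) by field. rewrite exp_plus.
    replace (2 / p * M * (exp (p / 2 * y) * exp (p / 2 * y))) with
      (2 / p * exp (p / 2 * y) * (M * exp (p / 2 * y))) by ring.
    apply Rmult_le_compat; [assumption|now apply pow_le| |assumption].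
    apply Rle_trans with (2 / p * (p / 2 * y)); [right; field; lra|].
    apply Rmult_le_compat_l; [apply Rdiv_le_0_compat; lra|lra].
Qed.

Lemma ln_nonneg (x : R) : 1 <= x -> 0 <= ln x.
Proof. intros H. rewrite <- ln_1. apply ln_le; lra. Qed.

(** In the variable [y = ln x] the growth [exp (y / 32)] is [x ^ (1/32)], which turns [1 / x] and
    [1 / x ^ 2] into the two prescribed powers. The factor 2 covers both terms of the derivative
    [(g1 (ln x) - g (ln x)) / x ^ 2]. *)
Lemma slowly_decaying_ln (M : R) (g G g1 : R -> R) :
  (forall y, is_derive G y (g y)) -> (forall y, is_derive g y (g1 y)) -> G 0 = 0 ->
  (forall y, 0 <= y -> Rabs (g y) <= M * exp (1 / 32 * y)) ->
  (forall y, 0 <= y -> Rabs (g1 y) <= M * exp (1 / 32 * y)) ->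
  slowly_decaying (2 * M) (fun x => g (ln x) / x) (fun x => G (ln x)).
Proof.
  intros DG Dg G0 Bg Bg1.
  assert (HM : 0 <= M).
  { specialize (Bg 0 (Rle_refl 0)). rewrite Rmult_0_r, exp_0 in Bg.
    assert (P := Rabs_pos (g 0)). lra. }
  assert (Dln : forall x, 1 <= x -> is_derive ln x (/ x)).
  { intros x Hx. apply is_derive_Reals, derivable_pt_lim_ln. lra. }
  split.
  - intros x Hx. unfold Rdiv. rewrite Rmult_comm.
    apply (is_derive_comp G ln x (g (ln x)) (/ x)); auto.
  - now rewrite ln_1.
  - intros x Hx. unfold Rdiv at 1. rewrite Rabs_mult.
    rewrite (Rabs_right (/ x)) by (apply Rle_ge, Rlt_le, Rinv_0_lt_compat; lra).
    replace (- (31 / 32)) with (1 / 32 + - (1)) by field.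
    rewrite Rpower_plus, Rpower_Ropp, Rpower_1 by lra.
    rewrite <- Rmult_assoc. apply Rmult_le_compat_r.
    + apply Rlt_le, Rinv_0_lt_compat; lra.
    + assert (B := Bg (ln x) (ln_nonneg x Hx)). fold (Rpower x (1 / 32)) in B.
      assert (P := Rpower_pos x (1 / 32)). nra.
  - exists (fun x => (g1 (ln x) - g (ln x)) / (x * x)). intros x Hx. split.
    + evar_last.
      * apply is_derive_div; [|apply is_derive_id|lra].
        apply (is_derive_comp g ln x (g1 (ln x)) (/ x)); auto.
      * unfold scal, one; simpl; unfold mult; simpl. field. lra.
    + unfold Rdiv at 1. rewrite Rabs_mult.
      assert (I : 0 < / (x * x)) by (apply Rinv_0_lt_compat; nra).
      rewrite (Rabs_right (/ (x * x))) by lra.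
      replace (- (63 / 32)) with (1 / 32 + - (1 + 1)) by field.
      rewrite (Rpower_plus (1 / 32)), Rpower_Ropp, (Rpower_plus 1 1), Rpower_1 by lra.
      rewrite <- Rmult_assoc. apply Rmult_le_compat_r; [lra|].
      assert (B := Bg (ln x) (ln_nonneg x Hx)). assert (B1 := Bg1 (ln x) (ln_nonneg x Hx)).
      fold (Rpower x (1 / 32)) in B, B1.
      unfold Rminus. eapply Rle_trans; [apply Rabs_triang|]. rewrite Rabs_Ropp. lra.
Qed.

Lemma slowly_decaying_ln_pow (m : nat) : exists M,
  slowly_decaying M (fun x => ln x ^ m / x) (fun x => ln x ^ (m + 1) / (INR m + 1)).
Proof.
  destruct (pow_le_exp (1 / 32) m) as (M & HM & H); [lra|].
  destruct (pow_le_exp (1 / 32) (pred m)) as (M1 & HM1 & H1); [lra|].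
  exists (2 * (M + INR m * M1)).
  assert (Hm := pos_INR m).
  apply (slowly_decaying_ln _ (fun y => y ^ m) (fun y => y ^ (m + 1) / (INR m + 1))
    (fun y => INR m * y ^ pred m)).
  - intros y. auto_derive; [trivial|]. rewrite Nat.add_1_r, S_INR. simpl. field. lra.
  - intros y. auto_derive; [trivial|]. ring.
  - rewrite Nat.add_1_r. simpl. field. lra.
  - intros y Hy. rewrite Rabs_right by (apply Rle_ge; now apply pow_le).
    specialize (H y Hy). assert (P := exp_pos (1 / 32 * y)).
    assert (0 <= INR m * M1) by (now apply Rmult_le_pos). nra.
  - intros y Hy. rewrite Rabs_right.
    + specialize (H1 y Hy). assert (P := exp_pos (1 / 32 * y)).
      apply (Rmult_le_compat_l _ _ _ Hm) in H1. nra.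
    + apply Rle_ge, Rmult_le_pos; [assumption|now apply pow_le].
Qed.

(** Taylor remainder of [exp (- y)] at 0; the index [n] counts the terms removed, so it is also the
    order of vanishing. *)
Fixpoint exp_neg_remainder (n : nat) (y : R) : R :=
  match n with
  | O => exp (- y)
  | S m => exp_neg_remainder m y - (- y) ^ m / INR (fact m)
  end.

(** Up to sign, raising the index is integration from 0. This yields both the size bound, by
    induction, and the antiderivatives used in regularized sums. *)
Lemma is_derive_exp_neg_remainder (n : nat) (y : R) :
  is_derive (exp_neg_remainder (S n)) y (- exp_neg_remainder n y).
Proof.
  induction n as [|n IH].
  - simpl. auto_derive; [trivial|]. ring.
  - change (exp_neg_remainder (S (S n))) with
      (fun y => exp_neg_remainder (S n) y - (- y) ^ S n / INR (fact (S n))).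
    assert (D : forall q, is_derive (fun y => (- y) ^ S n / q) y (- (INR (S n) * (- y) ^ n / q))).
    { intros q. unfold Rdiv. auto_derive; [trivial|]. change (match n with O => 1 | S _ => INR n + 1 end) with (INR (S n)). ring. }
    evar_last.
    + apply (is_derive_minus (exp_neg_remainder (S n))); [exact IH|apply D].
    + change (exp_neg_remainder (S n) y) with (exp_neg_remainder n y - (- y) ^ n / INR (fact n)).
      rewrite fact_simpl, mult_INR.
      assert (F := INR_fact_neq_0 n). assert (0 < INR (S n)) by (apply lt_0_INR; lia).
      unfold minus, plus, opp. cbn -[INR fact pow exp_neg_remainder]. field. lra.
Qed.

Lemma exp_neg_remainder_0 (n : nat) : exp_neg_remainder (S n) 0 = 0.
Proof.
  induction n as [|n IH].
  - simpl. rewrite Ropp_0, exp_0. field.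
  - change (exp_neg_remainder (S n) 0 - (- 0) ^ S n / INR (fact (S n)) = 0).
    rewrite IH, Ropp_0, pow_ne_zero by lia. unfold Rdiv. ring.
Qed.

Lemma exp_neg_remainder_bound (n : nat) (y : R) : 0 <= y -> Rabs (exp_neg_remainder n y) <= y ^ n.
Proof.
  revert y. induction n as [|n IH]; intros y Hy.
  - simpl. rewrite Rabs_right by (apply Rle_ge, Rlt_le, exp_pos).
    rewrite <- exp_0. destruct (Req_dec y 0) as [->|]; [rewrite Ropp_0; lra|].
    apply Rlt_le, exp_increasing. lra.
  - replace (exp_neg_remainder (S n) y)
      with (exp_neg_remainder (S n) y - exp_neg_remainder (S n) 0)
      by (rewrite exp_neg_remainder_0; ring).
    eapply Rle_trans; [apply (MVT_le _ (fun t => - exp_neg_remainder n t) 0 y (y ^ n) Hy)|].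
    + intros t _. apply is_derive_exp_neg_remainder.
    + intros t Ht. rewrite Rabs_Ropp. eapply Rle_trans; [apply IH; lra|].
      now apply pow_incr.
    + simpl. right. ring.
Qed.

(** Here [M] does not depend on [d]: the remainder at [d * y] is at most [(d y) ^ (n + 1)] and its
    derivative in [y] at most [d * (d y) ^ n], so [d ^ (n + 1)] factors out of both. This is the
    source of the error term in the expansion at the pole. *)
Lemma slowly_decaying_exp_neg_remainder (n : nat) : exists M, forall d, 0 < d ->
  slowly_decaying (M * d ^ S n) (fun x => exp_neg_remainder (S n) (d * ln x) / x)
    (fun x => - exp_neg_remainder (S (S n)) (d * ln x) / d).
Proof.
  destruct (pow_le_exp (1 / 32) n) as (M1 & HM1 & H1); [lra|].
  destruct (pow_le_exp (1 / 32) (S n)) as (M2 & HM2 & H2); [lra|].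
  exists (2 * (M1 + M2)). intros d Hd. rewrite Rmult_assoc.
  assert (D : forall m y, is_derive (fun y => exp_neg_remainder (S m) (d * y)) y
    (- d * exp_neg_remainder m (d * y))).
  { intros m y. evar_last.
    - apply (is_derive_comp (exp_neg_remainder (S m)) (fun y => d * y)).
      + apply is_derive_exp_neg_remainder.
      + auto_derive; [trivial|reflexivity].
    - unfold scal; simpl; unfold mult; simpl. ring. }
  assert (Hdn : 0 < d ^ S n) by (now apply pow_lt).
  assert (B : forall m y, 0 <= y -> Rabs (exp_neg_remainder m (d * y)) <= d ^ m * y ^ m).
  { intros m y Hy. rewrite <- Rpow_mult_distr. apply exp_neg_remainder_bound.
    apply Rmult_le_pos; lra. }
  apply (slowly_decaying_ln _ (fun y => exp_neg_remainder (S n) (d * y))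
    (fun y => - exp_neg_remainder (S (S n)) (d * y) / d)
    (fun y => - d * exp_neg_remainder n (d * y))).
  - intros y. evar_last.
    + apply is_derive_ext with (fun y => (- / d) * exp_neg_remainder (S (S n)) (d * y)).
      { intros t. cbn -[exp_neg_remainder]. field. lra. }
      apply is_derive_scal. apply D.
    + cbn -[exp_neg_remainder]. field. lra.
  - intros y. apply D.
  - rewrite Rmult_0_r, exp_neg_remainder_0. field. lra.
  - intros y Hy. eapply Rle_trans; [apply B; assumption|].
    replace ((M1 + M2) * d ^ S n * exp (1 / 32 * y))
      with (d ^ S n * ((M1 + M2) * exp (1 / 32 * y))) by ring.
    apply Rmult_le_compat_l; [lra|]. specialize (H2 y Hy).
    assert (P := exp_pos (1 / 32 * y)). nra.
  - intros y Hy. rewrite Rabs_mult, Rabs_Ropp, (Rabs_right d) by lra.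
    apply Rle_trans with (d * (d ^ n * y ^ n)).
    + apply Rmult_le_compat_l; [lra|]. now apply B.
    + replace ((M1 + M2) * d ^ S n * exp (1 / 32 * y))
        with (d * (d ^ n * ((M1 + M2) * exp (1 / 32 * y)))) by (simpl; ring).
      apply Rmult_le_compat_l; [lra|]. apply Rmult_le_compat_l; [apply pow_le; lra|].
      specialize (H1 y Hy). assert (P := exp_pos (1 / 32 * y)). nra.
Qed.

(** One Taylor term is peeled off the function and, one index higher, the matching term off its
    antiderivative. *)
Lemma regularized_sum_exp_neg_remainder_S (a : nat -> R) (c d : R) (n N : nat) : d <> 0 ->
  regularized_sum a c (fun x => exp_neg_remainder (S n) (d * ln x) / x)
    (fun x => - exp_neg_remainder (S (S n)) (d * ln x) / d) N =
  regularized_sum a c (fun x => exp_neg_remainder n (d * ln x) / x)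
    (fun x => - exp_neg_remainder (S n) (d * ln x) / d) N -
  (- d) ^ n / INR (fact n) * regularized_sum a c (fun x => ln x ^ n / x)
    (fun x => ln x ^ (n + 1) / (INR n + 1)) N.
Proof.
  intros Hd. unfold regularized_sum.
  assert (F := INR_fact_neq_0 n). assert (Hn := pos_INR n).
  assert (E : sum_n_m (fun j => a j * (exp_neg_remainder (S n) (d * ln (INR j)) / INR j)) 1 N =
    sum_n_m (fun j => a j * (exp_neg_remainder n (d * ln (INR j)) / INR j)) 1 N +
    - ((- d) ^ n / INR (fact n)) * sum_n_m (fun j => a j * (ln (INR j) ^ n / INR j)) 1 N).
  { rewrite <- sum_n_m_Rmult, <- sum_n_m_Rplus. apply sum_n_m_ext_loc. intros j Hj. simpl.
    replace (- (d * ln (INR j))) with (- d * ln (INR j)) by ring. rewrite Rpow_mult_distr.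
    field. split; [|assumption]. apply not_0_INR. lia. }
  rewrite E.
  change (exp_neg_remainder (S (S n)) (d * ln (INR N))) with
    (exp_neg_remainder (S n) (d * ln (INR N)) - (- (d * ln (INR N))) ^ S n / INR (fact (S n))).
  rewrite fact_simpl, mult_INR, S_INR, Nat.add_1_r.
  replace (- (d * ln (INR N))) with (- d * ln (INR N)) by ring. rewrite Rpow_mult_distr.
  rewrite <- !tech_pow_Rmult. field. repeat split; lra || assumption.
Qed.

Lemma regularized_sum_expansion (a : nat -> R) (c d F : R) (L : nat -> R) : 0 < d ->
  is_lim_seq (fun N => sum_n_m (fun j => a j * Rpower (INR j) (- (1 + d))) 1 N) F ->
  (forall m, is_lim_seq (regularized_sum a c (fun x => ln x ^ m / x)
    (fun x => ln x ^ (m + 1) / (INR m + 1))) (L m)) ->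
  forall n, is_lim_seq
    (regularized_sum a c (fun x => exp_neg_remainder (S n) (d * ln x) / x)
      (fun x => - exp_neg_remainder (S (S n)) (d * ln x) / d))
    (F - c / d - sum_n (fun m => (-1) ^ m * L m / INR (fact m) * d ^ m) n).
Proof.
  intros Hd HF HL.
  assert (Step : forall n l l', is_lim_seq
    (regularized_sum a c (fun x => exp_neg_remainder n (d * ln x) / x)
      (fun x => - exp_neg_remainder (S n) (d * ln x) / d)) (Finite l) ->
    l' = l - (-1) ^ n * L n / INR (fact n) * d ^ n ->
    is_lim_seq
    (regularized_sum a c (fun x => exp_neg_remainder (S n) (d * ln x) / x)
      (fun x => - exp_neg_remainder (S (S n)) (d * ln x) / d)) l').
  { intros n l l' H ->.
    eapply is_lim_seq_ext.
    { intros N. symmetry. apply regularized_sum_exp_neg_remainder_S. lra. }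
    replace ((-1) ^ n * L n / INR (fact n) * d ^ n) with ((- d) ^ n / INR (fact n) * L n).
    - apply is_lim_seq_minus'; [exact H|].
      apply (is_lim_seq_scal_l _ ((- d) ^ n / INR (fact n)) (L n)). apply HL.
    - replace (- d) with (-1 * d) by ring. rewrite Rpow_mult_distr. field.
      apply INR_fact_neq_0. }
  induction n as [|n IH].
  (* At index 0 the function is [x ^ (- 1 - d)], with integral [(1 - N ^ (- d)) / d] up to [N]; its
     limit [1 / d] produces the polar part [c / d]. *)
  - apply (Step 0%nat (F - c / d)); [|now rewrite sum_O].
    apply is_lim_seq_incr_1.
    apply is_lim_seq_ext with (fun N => sum_n_m (fun j => a j * Rpower (INR j) (- (1 + d))) 1 (S N)
      - (c / d - c / d * Rpower (INR (S N)) (- d))).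
    { intros N. unfold regularized_sum. f_equal.
      - apply sum_n_m_ext_loc. intros j Hj. simpl. f_equal.
        assert (0 < INR j) by (apply lt_0_INR; lia).
        replace (- (1 + d)) with (- (1) + - d) by ring.
        rewrite Rpower_plus, Rpower_Ropp, Rpower_1 by assumption. unfold Rpower, Rdiv.
        rewrite Ropp_mult_distr_l. ring.
      - unfold Rpower. simpl exp_neg_remainder. rewrite Ropp_mult_distr_l. simpl. field. lra. }
    apply is_lim_seq_minus'.
    + apply (is_lim_seq_incr_1 (fun N => sum_n_m (fun j => a j * Rpower (INR j) (- (1 + d))) 1 N)).
      exact HF.
    + replace (Finite (c / d)) with (Finite (c / d - c / d * 0)) by (f_equal; ring).
      apply is_lim_seq_minus'; [apply is_lim_seq_const|].
      apply (is_lim_seq_scal_l _ (c / d) 0).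
      apply (is_lim_seq_incr_1 (fun n => Rpower (INR n) (- d))).
      now apply is_lim_seq_Rpower_neg.
  - apply (Step (S n) _ _ IH). rewrite sum_Sn. unfold plus. cbn -[pow fact INR]. ring.
Qed.

(** * Identification of the coefficients *)

Lemma is_series_pow_bounded (b : nat -> R) (x l : R) : is_series (fun m => b m * x ^ m) l ->
  exists B, 0 <= B /\ forall m, Rabs (b m * x ^ m) <= B.
Proof.
  intros H. assert (Z := ex_series_lim_0 _ (ex_intro _ l H)).
  destruct (filterlim_bounded (V := R_NormedModule) (fun m => b m * x ^ m)) as [B HB].
  - exists 0. exact Z.
  - exists B. split; [|exact HB]. eapply Rle_trans; [|apply (HB 0%nat)]. apply norm_ge_0.
Qed.

(** Convergence at [r / 2] bounds the terms there, so for [d < r / 4] the series is dominated by a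
    geometric one of ratio [q = 2 d / r < 1/2]. *)
Lemma power_series_tail_bound (b : nat -> R) (g : R -> R) (r : R) : 0 < r ->
  (forall d, 0 < d < r -> is_series (fun m => b m * d ^ m) (g d)) ->
  exists rho, 0 < rho < r /\ forall n, exists C1, forall d, 0 < d < rho ->
    Rabs (g d - sum_n (fun m => b m * d ^ m) n) <= C1 * d ^ S n.
Proof.
  intros Hr H. destruct (is_series_pow_bounded b (r / 2) _ (H (r / 2) ltac:(lra))) as (B & HB & Hb).
  exists (r / 4). split; [lra|]. intros n. exists (2 * B * (2 / r) ^ S n). intros d Hd.
  set (q := 2 / r * d).
  assert (Hq : 0 < q < 1 / 2).
  { unfold q. split; [apply Rmult_lt_0_compat; [apply Rdiv_lt_0_compat|]; lra|].
    apply Rlt_le_trans with (2 / r * (r / 4)); [|right; field; lra].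
    apply Rmult_lt_compat_l; [apply Rdiv_lt_0_compat|]; lra. }
  assert (Hterm : forall m, Rabs (b m * d ^ m) <= B * q ^ m).
  { intros m. replace (b m * d ^ m) with (b m * (r / 2) ^ m * q ^ m).
    - rewrite Rabs_mult, (Rabs_right (q ^ m)) by (apply Rle_ge, pow_le; lra).
      apply Rmult_le_compat_r; [apply pow_le; lra|apply Hb].
    - rewrite Rmult_assoc, <- Rpow_mult_distr. do 2 f_equal. unfold q. field. lra. }
  (* The bound is telescoping: for [q <= 1/2] a new term [B q ^ (N + 1)] is at most
     [2 B (q ^ (N + 1) - q ^ (N + 2))]. *)
  assert (HN : forall N, (n <= N)%nat ->
    Rabs (sum_n (fun m => b m * d ^ m) N - sum_n (fun m => b m * d ^ m) n)
      <= 2 * B * (q ^ S n - q ^ S N)).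
  { intros N HN. induction HN as [|N HN IH].
    - rewrite !Rminus_diag, Rabs_R0. lra.
    - rewrite sum_Sn. unfold plus; cbn -[pow sum_n].
      replace (sum_n (fun m => b m * d ^ m) N + b (S N) * d ^ S N - sum_n (fun m => b m * d ^ m) n)
        with (sum_n (fun m => b m * d ^ m) N - sum_n (fun m => b m * d ^ m) n + b (S N) * d ^ S N)
        by ring.
      eapply Rle_trans; [apply Rabs_triang|].
      specialize (Hterm (S N)). assert (P : 0 <= B * q ^ S N) by (apply Rmult_le_pos, pow_le; lra).
      rewrite <- (tech_pow_Rmult q (S N)).
      assert (P2 : q * (B * q ^ S N) <= 1 / 2 * (B * q ^ S N)) by (apply Rmult_le_compat_r; lra).
      lra. }
  rewrite Rmult_assoc, <- Rpow_mult_distr. fold q.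
  apply (is_lim_seq_le_loc (fun N => Rabs (sum_n (fun m => b m * d ^ m) N - sum_n (fun m => b m * d ^ m) n))
    (fun _ => 2 * B * q ^ S n) (Rabs (g d - sum_n (fun m => b m * d ^ m) n)) (2 * B * q ^ S n)).
  - exists n. intros N HNn. eapply Rle_trans; [apply (HN N HNn)|].
    apply Rmult_le_compat_l; [lra|]. assert (P : 0 < q ^ S N) by (apply pow_lt; lra). lra.
  - apply (is_lim_seq_abs _ (g d - sum_n (fun m => b m * d ^ m) n)).
    apply (is_lim_seq_minus' _ _ (g d)); [|apply is_lim_seq_const].
    apply (H d). lra.
  - apply is_lim_seq_const.
Qed.

(** The sequence [e] gives an asymptotic expansion as [d] tends to 0 from the right. At the first
    index where the coefficients differ, the two expansions force [Rabs (b n - e n) <= C * d] for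
    all small [d > 0]. *)
Lemma power_series_asymptotic_unique (b e : nat -> R) (g : R -> R) (r : R) : 0 < r ->
  (forall d, 0 < d < r -> is_series (fun m => b m * d ^ m) (g d)) ->
  (forall n, exists C1, forall d, 0 < d < r ->
    Rabs (g d - sum_n (fun m => e m * d ^ m) n) <= C1 * d ^ S n) ->
  forall n, b n = e n.
Proof.
  intros Hr Hb He.
  destruct (power_series_tail_bound b g r Hr Hb) as (rho & Hrho & T).
  apply (well_founded_induction lt_wf). intros n IH.
  destruct (T n) as (C1 & H1). destruct (He n) as (C2 & H2).
  assert (Diff : forall d, sum_n (fun m => b m * d ^ m) n - sum_n (fun m => e m * d ^ m) n
    = (b n - e n) * d ^ n).
  { intros d. destruct n as [|n]; [rewrite !sum_O; ring|].
    rewrite !sum_Sn, (sum_n_ext_loc (fun m => b m * d ^ m) (fun m => e m * d ^ m)).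
    - unfold plus; cbn -[pow sum_n]. ring.
    - intros m Hm. rewrite IH by lia. reflexivity. }
  destruct (Req_dec (b n) (e n)) as [E|E]; [exact E|exfalso].
  assert (P : 0 < Rabs (b n - e n)) by (apply Rabs_pos_lt; lra).
  assert (K : forall d, 0 < d < rho -> Rabs (b n - e n) <= (C1 + C2) * d).
  { intros d Hd. assert (Hdn : 0 < d ^ n) by (apply pow_lt; lra).
    apply Rmult_le_reg_r with (d ^ n); [assumption|].
    rewrite <- (Rabs_right (d ^ n)) at 1 by lra. rewrite <- Rabs_mult, <- Diff.
    specialize (H1 d Hd). specialize (H2 d ltac:(lra)). rewrite <- tech_pow_Rmult in H1, H2.
    apply Rabs_le_between in H1, H2. apply Rabs_le. lra. }
  set (A := Rabs (b n - e n)) in *.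
  assert (C12 : 0 < C1 + C2) by (specialize (K (rho / 2) ltac:(lra)); nra).
  (* This choice makes [(C1 + C2) * d] at most [A / 2], contradicting [K]. *)
  set (d := Rmin (rho / 2) (A / (2 * (C1 + C2)))).
  assert (Hd : 0 < d) by (apply Rmin_pos; [lra|apply Rdiv_lt_0_compat; lra]).
  assert (Hd1 := Rmin_l (rho / 2) (A / (2 * (C1 + C2)))).
  assert (Hd2 := Rmin_r (rho / 2) (A / (2 * (C1 + C2)))). fold d in Hd1, Hd2.
  specialize (K d ltac:(lra)).
  apply (Rmult_le_compat_l (C1 + C2)) in Hd2; [|lra].
  replace ((C1 + C2) * (A / (2 * (C1 + C2)))) with (A / 2) in Hd2 by (field; lra). lra.
Qed.

(** * From integer to real cut-offs *)

Lemma floor_nat_bounds (x : R) : 1 <= x ->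
  (1 <= Z.to_nat (Int_part x))%nat /\
  INR (Z.to_nat (Int_part x)) <= x < INR (Z.to_nat (Int_part x)) + 1.
Proof.
  intros Hx. destruct (base_Int_part x) as [H1 H2].
  assert (Z1 : (0 < Int_part x)%Z) by (apply lt_IZR; lra).
  rewrite INR_IZR_INZ, Z2Nat.id by lia. split; [lia|lra].
Qed.

Lemma filterlim_floor_nat :
  filterlim (fun x => Z.to_nat (Int_part x)) (Rbar_locally p_infty) eventually.
Proof.
  intros P [N HN]. exists (INR N + 1). intros x Hx. apply HN.
  assert (HN0 := pos_INR N). destruct (floor_nat_bounds x) as [_ H]; [lra|].
  apply INR_le. lra.
Qed.

(** Between the integer part of [x] and [x] the sum is constant, while [Phi] moves by at most the
    bound of [phi] on a unit interval, which tends to 0. *)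
Lemma regularized_sum_floor (a : nat -> R) (c M : R) (phi Phi : R -> R) (L : R) :
  slowly_decaying M phi Phi -> is_lim_seq (regularized_sum a c phi Phi) L ->
  is_lim (fun x => sum_upto (fun j => a j * phi (INR j)) x - c * Phi x) p_infty L.
Proof.
  intros SD HL. assert (HM := slowly_decaying_nonneg _ _ _ SD).
  destruct SD as [D1 HP B1 _]. set (fl := fun x => Z.to_nat (Int_part x)).
  set (e := fun N => Rabs c * M * Rpower (INR N) (- (31 / 32))).
  assert (He : is_lim_seq e 0).
  { replace (Finite 0) with (Rbar_mult (Rabs c * M) 0) by (simpl; f_equal; ring).
    apply is_lim_seq_scal_l.
    apply is_lim_seq_Rpower_neg. lra. }
  assert (Hfl : forall u l, is_lim_seq u (Finite l) -> is_lim (fun x => u (fl x)) p_infty l).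
  { intros u l Hu. exact (filterlim_comp _ _ _ fl u _ _ _ filterlim_floor_nat Hu). }
  apply is_lim_ext with (fun x => regularized_sum a c phi Phi (fl x) + - c * (Phi x - Phi (INR (fl x)))).
  { intros x. unfold regularized_sum, sum_upto, fl. ring. }
  replace (Finite L) with (Finite (L + 0)) by (f_equal; ring).
  apply is_lim_plus'; [now apply Hfl|].
  apply (is_lim_le_le_loc (fun x => - e (fl x)) (fun x => e (fl x))).
  - exists 1. intros x Hx. destruct (floor_nat_bounds x) as [F1 F2]; [lra|]. fold (fl x) in F1, F2.
    apply (le_INR 1) in F1. simpl in F1. apply Rabs_le_between.
    rewrite Rabs_mult, Rabs_Ropp. unfold e. rewrite Rmult_assoc.
    apply Rmult_le_compat_l; [apply Rabs_pos|].
    assert (P := Rpower_pos (INR (fl x)) (- (31 / 32))).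
    eapply Rle_trans; [apply (MVT_le Phi phi _ _ (M * Rpower (INR (fl x)) (- (31 / 32))))|].
    + lra.
    + intros t Ht. apply D1. lra.
    + intros t Ht. eapply Rle_trans; [apply B1; lra|].
      apply Rmult_le_compat_l; [assumption|]. apply Rpower_antitone; lra.
    + assert (Q : 0 <= M * Rpower (INR (fl x)) (- (31 / 32))) by (apply Rmult_le_pos; lra). nra.
  - replace (Finite 0) with (Finite (- 0)) by (f_equal; ring).
    apply (is_lim_opp _ p_infty 0). now apply Hfl.
  - now apply Hfl.
Qed.

Lemma filterlim_RtoC (T : Type) (G : (T -> Prop) -> Prop) {FG : Filter G} (f : T -> R) (l : R) :
  filterlim f G (locally l) ->
  filterlim (fun x => RtoC (f x)) G (locally (T := C_NormedModule) (RtoC l)).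
Proof.
  intros H. apply (filterlim_locally (U := C_NormedModule)). intros eps.
  generalize (proj1 (filterlim_locally f l) H eps).
  apply filter_imp. intros x Hx. split; [exact Hx|apply ball_center].
Qed.

Theorem theorem1 (k : nat) (hk : (2 <= k)%nat)
  (zeta : C -> C) (hzeta : is_riemann_zeta zeta)
  (gamma : nat -> C)
  (hgamma : is_laurent_simple_pole
     (fun s : C => zeta s / zeta (RtoC (INR k) * s))%C
     (RtoC 1) (/ zeta (RtoC (INR k)))%C gamma)
  (n : nat) :
  filterlim
    (fun x : R =>
       (RtoC ((-1) ^ n)%R *
        (RtoC (sum_upto (fun j : nat => mu_kfree k j * ln (INR j) ^ n / INR j)%R x) -
         RtoC (ln x ^ (n + 1))%R /
           (zeta (RtoC (INR k)) * RtoC (INR n + 1)%R)))%C)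
    (Rbar_locally p_infty)
    (locally (T := C_NormedModule) (gamma n)).
Proof.
  assert (Hk := le_INR _ _ hk). simpl in Hk.
  destruct (zeta_real zeta (INR k) hzeta) as (z & Ez & Hz); [lra|].
  assert (Hz1 : 1 <= z) by apply (kfree_count_quotients k 1 z hk (le_n _) Hz).
  set (c := / z).
  destruct (regularized_sum_lim (mu_kfree k) c 100) as (C0 & HC0); [lra| |].
  { intros N HN. rewrite Rmult_comm. now apply kfree_count_remainder. }
  (* Description turns the existence of each limit into a sequence [L]; the same device below makes
     the quotient of zeta values a function of [d]. *)
  assert (HL : forall m, {l : R | is_lim_seq (regularized_sum (mu_kfree k) c
    (fun x => ln x ^ m / x) (fun x => ln x ^ (m + 1) / (INR m + 1))) l}).
  { intros m. apply constructive_indefinite_description.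
    destruct (slowly_decaying_ln_pow m) as (M & HM).
    destruct (HC0 _ _ _ HM) as (l & Hl & _). now exists l. }
  set (L := fun m => proj1_sig (HL m)).
  assert (HLm := fun m => proj2_sig (HL m) : is_lim_seq _ (L m)).
  assert (HF : forall d, 0 < d -> {F : R |
    is_lim_seq (fun N => sum_n_m (fun j => mu_kfree k j * Rpower (INR j) (- (1 + d))) 1 N) F /\
    (zeta (RtoC (1 + d)) / zeta (RtoC (INR k) * RtoC (1 + d)) = RtoC F)%C}).
  { intros d Hd. apply constructive_indefinite_description.
    destruct (zeta_real zeta (1 + d) hzeta) as (zs & Es & Hs); [lra|].
    destruct (zeta_real zeta (INR k * (1 + d)) hzeta) as (zk & Ek & Hks); [nra|].
    destruct (kfree_dirichlet_series k (1 + d) zs zk hk Hs Hks) as (F & HF & E).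
    exists F. split; [exact HF|].
    rewrite <- RtoC_mult, Es, Ek, E, RtoC_mult.
    (* The value [zk] is at least its first term 1, so the division is genuine. *)
    assert (zk <> 0).
    { assert (P := sum1_le_lim (fun j => Rpower (INR j) (- (INR k * (1 + d)))) zk 1
        (fun j => Rlt_le _ _ (Rpower_pos _ _)) Hks).
      rewrite sum_n_n in P. cbv beta in P. change (INR 1) with 1 in P.
      rewrite Rpower_1_l in P. lra. }
    field. intros Z. apply RtoC_inj in Z. contradiction. }
  assert (Hexp : forall m, gamma m = RtoC ((-1) ^ m * L m)).
  { destruct hgamma as (r & Hr & HG).
    (* The regular part at [1 + d]; the value 0 for [d <= 0] is a default, as only [0 < d < r]
       occurs. *)
    set (g := fun d => match Rlt_dec 0 d with
      | left Hd => proj1_sig (HF d Hd) - c / d | right _ => 0 end).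
    (* At real [s = 1 + d] the left side of the Laurent expansion is real: the real parts of the
       coefficients expand [g], the imaginary parts expand 0. *)
    assert (Hser : forall d, 0 < d < r ->
      is_series (fun m => Re (gamma m) / INR (fact m) * d ^ m) (g d) /\
      is_series (fun m => Im (gamma m) / INR (fact m) * d ^ m) 0).
    { intros d Hd. unfold g. destruct Rlt_dec as [H0|]; [|lra].
      destruct (HF d H0) as (F & HFl & EF). simpl.
      assert (Ed : (RtoC (1 + d) - RtoC 1)%C = RtoC d) by (rewrite RtoC_plus; ring).
      specialize (HG (RtoC (1 + d))). cbv beta in HG. rewrite Ed, EF, Ez in HG.
      rewrite Cmod_R, Rabs_right in HG by lra. specialize (HG Hd).
      assert (Hl : (RtoC F - / RtoC z / RtoC d)%C = RtoC (F - c / d)).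
      { unfold c. rewrite RtoC_minus, RtoC_div, RtoC_inv by lra. reflexivity. }
      rewrite Hl in HG.
      apply is_series_C_Re_Im in HG. destruct HG as [HR HI].
      assert (Et : forall m, (gamma m * (RtoC d ^ m / RtoC (INR (fact m))))%C =
        (Re (gamma m) / INR (fact m) * d ^ m, Im (gamma m) / INR (fact m) * d ^ m)).
      { intros m. rewrite <- RtoC_pow, <- RtoC_div by apply INR_fact_neq_0.
        destruct (gamma m) as [u v]. unfold RtoC, Cmult. simpl. f_equal; unfold Rdiv; ring. }
      split.
      - eapply is_series_ext; [|exact HR]. intros m. cbv beta. now rewrite Et.
      - eapply is_series_ext; [|exact HI]. intros m. cbv beta. now rewrite Et. }
    assert (HRe := power_series_asymptotic_unique (fun m => Re (gamma m) / INR (fact m))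
      (fun m => (-1) ^ m * L m / INR (fact m)) g r Hr (fun d Hd => proj1 (Hser d Hd))).
    assert (HIm := power_series_asymptotic_unique (fun m => Im (gamma m) / INR (fact m))
      (fun m => 0) (fun _ => 0) r Hr (fun d Hd => proj2 (Hser d Hd))).
    intros m. assert (F0 := INR_fact_neq_0 m).
    assert (E1 : Re (gamma m) = (-1) ^ m * L m).
    { apply Rmult_eq_reg_r with (/ INR (fact m)); [|now apply Rinv_neq_0_compat].
      apply HRe. clear m F0. intros m.
      (* The regularized sum of the remainder has two descriptions: it is [g d] minus the partial
         sum, and it is bounded by [C0 * M * d ^ (m + 1)] with [C0] and [M] independent of [d]. *)
      destruct (slowly_decaying_exp_neg_remainder m) as (M & HM). exists (C0 * M). intros d Hd.
      unfold g. destruct Rlt_dec as [H0|]; [|lra].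
      destruct (HF d H0) as (F & HFl & EF). simpl proj1_sig.
      destruct (HC0 _ _ _ (HM d H0)) as (l & Hl & Bl).
      assert (El := regularized_sum_expansion (mu_kfree k) c d F L H0 HFl HLm m).
      apply is_lim_seq_unique in Hl. apply is_lim_seq_unique in El.
      rewrite Hl in El. injection El as El. rewrite <- El, Rmult_assoc. exact Bl. }
    assert (E2 : Im (gamma m) = 0).
    { apply Rmult_eq_reg_r with (/ INR (fact m)); [|now apply Rinv_neq_0_compat].
      rewrite Rmult_0_l. apply HIm. intros p. exists 0. intros d _.
      rewrite (sum_n_ext _ (fun _ => 0)) by (intros; apply Rmult_0_l).
      rewrite sum_n_const, Rmult_0_r, Rminus_diag, Rabs_R0. lra. }
    rewrite <- E1. destruct (gamma m) as [u v]. simpl in E2. now rewrite E2. }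
  rewrite Hexp.
  destruct (slowly_decaying_ln_pow n) as (M & HM).
  assert (Lim := regularized_sum_floor _ c M _ _ (L n) HM (HLm n)).
  apply (is_lim_scal_l _ ((-1) ^ n)) in Lim.
  apply (filterlim_RtoC R (Rbar_locally p_infty) _ ((-1) ^ n * L n)) in Lim.
  eapply filterlim_ext; [|exact Lim].
  intros x. cbv beta. rewrite Ez.
  assert (Hn := pos_INR n).
  rewrite RtoC_mult. f_equal. rewrite RtoC_minus. f_equal.
  - f_equal. apply sum_n_m_ext. intros j. unfold Rdiv. now rewrite Rmult_assoc.
  - rewrite <- RtoC_mult, <- RtoC_div by nra. f_equal. unfold c. field. lra.
Qed.
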